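(* For every nonnegative integer $m$, the sequence $\{d_{\ell}(m)\}_{\ell=0}^{m}$ defined by $$d_{\ell}(m) = 2^{-2m} \sum_{k=\ell}^{m} 2^{k} \binom{2m-2k}{m-k}\binom{m+k}{m}\binom{k}{\ell}, \qquad 0\le \ell\le m,$$ is unimodal.
   Context: A finite sequence of real numbers $\{x_0,x_1,\dots,x_m\}$ is called unimodal if there exists an index $0\le j\le m$ such that $x_0\le x_1\le\cdots\le x_j$ and $x_j\ge x_{j+1}\ge\cdots\ge x_m$. *)

(* Defs.v *)
From mathcomp Require Import all_boot all_order all_algebra.

Set Implicit Arguments.
Unset Strict Implicit.
Unset Printing Implicit Defensive.

Import Order.TTheory GRing.Theory Num.Theory.
Local Open Scope ring_scope.

(* The finite sequence x_0, ..., x_m is given by a function on nat, of which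
   only the values at the indices 0, ..., m matter. *)
Definition unimodal (R : realFieldType) (m : nat) (x : nat -> R) : Prop :=
  exists j : nat,
    [/\ (j <= m)%N,
        forall i : nat, (i < j)%N -> x i <= x i.+1
      & forall i : nat, (j <= i < m)%N -> x i.+1 <= x i].

(* The subtractions on nat are never truncated, since k <= m in the sum. *)
Definition d (R : realFieldType) (m l : nat) : R :=
  2 ^- (2 * m) *
  \sum_(l <= k < m.+1)
    2 ^+ k * 'C(2 * m - 2 * k, m - k)%:R * 'C(m + k, m)%:R * 'C(k, l)%:R.

(* Main.v *)
Require Import Defs.
From mathcomp Require Import all_boot all_order all_algebra.
From mathcomp Require Import zify ring.

(** The generating polynomial of [d_l(m)] is [P(x + 1)], where [P] has the
    coefficients [b_k = 2^k C(2m-2k,m-k) C(m+k,m)] up to a positive factor, and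
    these are nonnegative and nondecreasing in [k].  For any such [b], the
    coefficients [c_l] of [P(x + 1)] satisfy
    [c_(l+1) - c_l = sum_k b_k (C(k,l+1) - C(k,l))], whose terms change sign from
    nonpositive to nonnegative at [k = 2l+1].  If [m <= 2l+1] the difference is
    thus nonpositive; otherwise it is at least
    [b_(2l+1) sum_k (C(k,l+1) - C(k,l))
       = b_(2l+1) (C(m+1,l+2) - C(m+1,l+1)) >= 0]. *)

Set Implicit Arguments.
Unset Strict Implicit.
Unset Printing Implicit Defensive.

Import Order.TTheory GRing.Theory Num.Theory.

Lemma leq_bin_succ n l : 2 * l < n -> 'C(n, l) <= 'C(n, l.+1).
Proof.
move=> lt_ln; rewrite -(leq_pmul2l (ltn0Sn l)) mul_bin_left.
by rewrite leq_mul2r; apply/orP; right; lia.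
Qed.

Lemma geq_bin_succ n l : n <= (2 * l).+1 -> 'C(n, l.+1) <= 'C(n, l).
Proof.
move=> le_nl; rewrite -(leq_pmul2l (ltn0Sn l)) mul_bin_left.
by rewrite leq_mul2r; apply/orP; right; lia.
Qed.

(** The hockey-stick identity, by iterating Pascal's rule. *)
Lemma sum_bin_upper n l : \sum_(k < n) 'C(k, l) = 'C(n, l.+1).
Proof.
by elim: n => [|n IHn]; rewrite ?big_ord0 // big_ord_recr /= IHn binS.
Qed.

Lemma central_bin_succ n :
  n.+1 * 'C(2 * n.+1, n.+1) = 2 * (2 * n).+1 * 'C(2 * n, n).
Proof.
have := mul_bin_diag (2 * n.+1) n; have := mul_bin_down (2 * n).+1 n.
have -> : (2 * n).+1 - n = n.+1 by lia.
have -> : (2 * n.+1).-1 = (2 * n).+1 by lia.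
by rewrite /= => *; nia.
Qed.

Definition shifted_coef (m k : nat) : nat :=
  2 ^ k * 'C(2 * m - 2 * k, m - k) * 'C(m + k, m).

(** With [n = m - k - 1], the ratio of the new value to the old is [(n+1)(m+k+1) / ((2n+1)(k+1))].
    It is at least 1 because [m+k+1 >= 2(k+1)] and [2(n+1) >= 2n+1]. *)
Lemma shifted_coef_succ m k :
  k < m -> shifted_coef m k <= shifted_coef m k.+1.
Proof.
move=> lt_km; rewrite /shifted_coef expnSr -!mulnA leq_mul2l.
apply/orP; right.
have [n def_m] : exists n, m = n + k.+1 by exists (m - k.+1); lia.
have -> : m - k = n.+1 by lia.
have -> : m - k.+1 = n by lia.
have -> : 2 * m - 2 * k = 2 * n.+1 by lia.
have -> : 2 * m - 2 * k.+1 = 2 * n by lia.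
have := central_bin_succ n; have := mul_bin_down (m + k.+1) m.
have -> : m + k.+1 - m = k.+1 by lia.
have -> : (m + k.+1).-1 = m + k by lia.
move: 'C(_, _) 'C(_, _) 'C(_, _) 'C(_, _) => E E' D' D eqD eqE.
rewrite -(leq_pmul2l (ltn0Sn n)) -(leq_pmul2l (ltn0Sn k)).
have -> : k.+1 * (n.+1 * (E' * D)) = k.+1 * (n.+1 * E') * D by ring.
have -> : k.+1 * (n.+1 * (2 * (E * D'))) = n.+1 * (2 * E) * (k.+1 * D') by ring.
rewrite eqE -eqD.
have -> : k.+1 * (2 * (2 * n).+1 * E) * D
        = (k.+1 * (2 * n).+1) * (2 * E * D) by ring.
have -> : n.+1 * (2 * E) * ((m + k.+1) * D)
        = (n.+1 * (m + k.+1)) * (2 * E * D) by ring.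
by rewrite leq_mul2r; apply/orP; right; nia.
Qed.

Local Open Scope ring_scope.

Lemma unimodal_scale (R : realFieldType) (m : nat) (c : R) (x : nat -> R) :
  0 <= c -> unimodal m x -> unimodal m (fun l => c * x l).
Proof.
move=> c_ge0 [j [le_jm x_incr x_decr]]; exists j.
by split=> // i hi; apply: ler_wpM2l; auto.
Qed.

Lemma unimodal_shift (R : realFieldType) (m : nat) (b : nat -> R) :
    (forall k, 0 <= b k) -> (forall k, (k < m)%N -> b k <= b k.+1) ->
  unimodal m (fun l => \sum_(l <= k < m.+1) b k * 'C(k, l)%:R).
Proof.
move=> b_ge0 b_incr.
have b_mono i k : (i <= k)%N -> (k <= m)%N -> b i <= b k.
  elim: k => [|k IHk]; first by rewrite leqn0 => /eqP ->.
  rewrite leq_eqVlt => /orP[/eqP -> //|le_ik lt_km].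
  exact: le_trans (IHk le_ik (ltnW lt_km)) (b_incr _ lt_km).
(* Since ['C(k, l) = 0] for [k < l], the range can be made independent of [l], so that consecutive
   sums subtract term by term. *)
have sumE l : (l <= m.+1)%N -> \sum_(l <= k < m.+1) b k * 'C(k, l)%:R
                = \sum_(k < m.+1) b k * 'C(k, l)%:R.
  move=> le_lm; rewrite -(big_mkord xpredT (fun k => b k * 'C(k, l)%:R)).
  rewrite [RHS](big_cat_nat (n := l)) //= [X in _ = X + _]big1_seq ?add0r //.
  move=> k /=; rewrite mem_index_iota => /andP[_ lt_kl].
  by rewrite bin_small // mulr0.
(* [l < m./2] holds exactly when [2l+1 < m]. *)
exists m./2; split; first by lia.
- move=> l lt_l; rewrite !sumE; try lia.
  (* Both factors change sign at [k = 2l+1], so no product is negative. *)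
  have nonneg : 0 <= \sum_(k < m.+1)
      (b k - b (2 * l).+1) * ('C(k, l.+1)%:R - 'C(k, l)%:R).
    apply: sumr_ge0 => k _; case: (leqP k (2 * l).+1) => hk.
      apply: mulr_le0; rewrite subr_le0; first by apply: b_mono => //; lia.
      by rewrite ler_nat geq_bin_succ.
    apply: mulr_ge0; rewrite subr_ge0.
      by apply: b_mono; [lia | rewrite -ltnS].
    by rewrite ler_nat leq_bin_succ //; lia.
  have sum_bin_ge : 0 <= b (2 * l).+1 *
      \sum_(k < m.+1) ('C(k, l.+1)%:R - 'C(k, l)%:R) :> R.
    (* What remains is ['C(m+1, l+1) <= 'C(m+1, l+2)], which needs [2(l+1) < m+1]. *)
    apply: mulr_ge0 => //; rewrite sumrB -!natr_sum !sum_bin_upper subr_ge0.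
    by rewrite ler_nat leq_bin_succ //; lia.
  rewrite -subr_ge0 -sumrB; apply: le_trans (addr_ge0 nonneg sum_bin_ge) _.
  rewrite mulr_sumr -big_split /= le_eqVlt; apply/orP; left; apply/eqP.
  by apply: eq_bigr => k _; ring.
- move=> l /andP[le_l lt_l]; rewrite !sumE; try lia.
  (* Here [k <= m <= 2l+1] for every index, so the comparison is termwise. *)
  apply: ler_sum => k _; apply: ler_wpM2l => //.
  by rewrite ler_nat geq_bin_succ //; have := ltn_ord k; lia.
Qed.

Theorem theorem1p2 (R : realFieldType) (m : nat) : unimodal m (fun l : nat => d R m l).
Proof.
have H : unimodal m (fun l => \sum_(l <= k < m.+1)
                       (shifted_coef m k)%:R * 'C(k, l)%:R : R).
  apply: unimodal_shift => k; first exact: ler0n.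
  by move=> lt_km; rewrite ler_nat shifted_coef_succ.
have c_ge0 : 0 <= 2 ^- (2 * m) :> R by rewrite invr_ge0 exprn_ge0.
have eq_d l : 2 ^- (2 * m) * (\sum_(l <= k < m.+1)
    (shifted_coef m k)%:R * 'C(k, l)%:R) = d R m l.
  by congr (_ * _); apply: eq_bigr => k _; rewrite /shifted_coef !natrM natrX.
have [j [le_jm incr decr]] := unimodal_scale c_ge0 H.
by exists j; split=> // i hi; rewrite -!eq_d; auto.
Qed.
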